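(* Let $l \geq 1$ be an integer, let $F: \mathbf{N} \to \mathbf{N}$ be a function, and let $\varepsilon > 0$. Then there exists an integer $M^* > 0$ (depending only on $l$, $F$, $\varepsilon$) with the following property: if $P \geq 1$ is an integer and $f_1,\ldots,f_l: \mathbf{Z}_P^l \to [-1,1]$ are arbitrary functions, then there exists an integer $1 \leq M \leq M^*$ such that $$\| A_N(f_1,\ldots,f_l) - A_{N'}(f_1,\ldots,f_l) \|_{L^2(\mathbf{Z}_P^l)} \leq \varepsilon$$ for all integers $N,N'$ with $M \leq N, N' \leq F(M)$.
   Context: $\mathbf{N} = \{1,2,3,\ldots\}$. $\mathbf{Z}_P = \mathbf{Z}/P\mathbf{Z}$, and $e_1,\ldots,e_l$ are the standard generators of $\mathbf{Z}_P^l$. For $f_1,\ldots,f_l: \mathbf{Z}_P^l \to \mathbf{R}$ and $N \geq 1$, the function $A_N(f_1,\ldots,f_l): \mathbf{Z}_P^l \to \mathbf{R}$ is $$A_N(f_1,\ldots,f_l)(a) := \frac{1}{N}\sum_{n=0}^{N-1}\prod_{i=1}^l f_i(a + n e_i).$$ The $L^2(\mathbf{Z}_P^l)$ norm is taken with respect to the uniform probability measure on $\mathbf{Z}_P^l$. *)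

(* Defs.v *)
From HB Require Import structures.
From mathcomp Require Import all_boot all_order all_algebra.
From mathcomp Require Import reals.

Set Implicit Arguments.
Unset Strict Implicit.
Unset Printing Implicit Defensive.

Import Order.TTheory GRing.Theory Num.Theory.
Local Open Scope ring_scope.

(* Z/PZ for P >= 1. MathComp's 'Z_P cannot be used here: 'Z_1 is Z/2Z,
   whereas 'I_P.-1.+1 is the additive group of integers mod P for every
   P >= 1, including P = 1. The value at P = 0 is junk (the trivial group). *)
Notation Zmod P := 'I_(P.-1.+1).

Notation torus P l := 'rV[Zmod P]_l.

(* [inZp 1] is the class of 1 mod P (which is 0 when P = 1). *)
Definition gen (P l : nat) (i : 'I_l) : torus P l :=
  \row_(j < l) (if j == i then inZp 1 else 0).

Definition ergodic_avg (R : realType) (P l : nat)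
    (f : 'I_l -> torus P l -> R) (N : nat) (a : torus P l) : R :=
  N%:R^-1 * \sum_(0 <= n < N) \prod_(i < l) f i (a + gen P i *+ n).

Definition L2norm (R : realType) (T : finType) (g : T -> R) : R :=
  Num.sqrt (#|T|%:R^-1 * \sum_(x : T) `|g x| ^+ 2).

(* Main.v *)
Require Import Defs.
From HB Require Import structures.
From mathcomp Require Import all_boot all_order all_algebra.
From mathcomp Require Import reals boolp ring lra zify.

Set Implicit Arguments.
Unset Strict Implicit.
Unset Printing Implicit Defensive.

Import Order.TTheory GRing.Theory Num.Theory.
Local Open Scope ring_scope.

(** Induction on [l], over all finite abelian groups and all generators at once.
    Fix all functions but one and let [S_N] be the average as an operator on the
    remaining function [r].  If [S_N r] has norm greater than [delta], replacing
    [r] by [r - S_N^* S_N r] lowers the energy [||r||^2] by at least [delta^2]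
    and at most doubles the sup norm of [r]; so after boundedly many steps all
    [S_N r] in the relevant range of [N] are small.  The removed part
    [S_N^* w] is structured: for [M] much smaller than [N],
    [S_M (S_N^* w)] is, up to [O(M/N)], a mean over [n < N] of bounded multiples
    of averages of one function fewer.  Adjoining [n] as an inert coordinate of
    the group makes these a single average on [G * 'I_N], to which the induction
    hypothesis applies.  The scales [N] are chosen in decreasing order. *)

(* MathComp gives products the [finType] and [zmodType] structures but not their
   join. *)
HB.instance Definition _ (A B : finZmodType) := GRing.Zmodule.on (A * B)%type.

(** * Cauchy-Schwarz and elementary bounds on means *)

Lemma sum_cauchy_schwarz (R : realDomainType) (I : Type) (s : seq I)
    (x y : I -> R) :
  (\sum_(i <- s) x i * y i) ^+ 2
    <= (\sum_(i <- s) x i ^+ 2) * (\sum_(i <- s) y i ^+ 2).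
Proof.
elim: s => [|i s IH]; first by rewrite !big_nil mul0r expr0n.
rewrite !big_cons.
have : 0 <= \sum_(j <- s) x j ^+ 2 by apply: sumr_ge0 => j _; apply: sqr_ge0.
have : 0 <= \sum_(j <- s) y j ^+ 2 by apply: sumr_ge0 => j _; apply: sqr_ge0.
move: IH; move: (\sum_(j <- s) _ * _) (\sum_(j <- s) x j ^+ 2)
  (\sum_(j <- s) y j ^+ 2) (x i) (y i) => p A B a b hp hB hA.
have ha : 0 <= a ^+ 2 := sqr_ge0 a.
have hb : 0 <= b ^+ 2 := sqr_ge0 b.
suff : 2 * (a * b * p) <= a ^+ 2 * B + A * b ^+ 2 by lra.
have h0 : 0 <= a ^+ 2 * B + A * b ^+ 2 by apply: addr_ge0; apply: mulr_ge0.
apply: (le_trans (ler_norm _)).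
rewrite -(@ler_pXn2r _ 2) ?nnegrE // real_normK ?num_real //.
have h1 : (a * b) ^+ 2 * p ^+ 2 <= (a * b) ^+ 2 * (A * B).
  by rewrite ler_wpM2l ?sqr_ge0.
(* After squaring, this is AM-GM for [a ^+ 2 * B] and [A * b ^+ 2]. *)
have := sqr_ge0 (a ^+ 2 * B - A * b ^+ 2).
lra.
Qed.

Lemma sqr_mean_le (R : realType) (N : nat) (x : nat -> R) :
  (N%:R^-1 * \sum_(0 <= n < N) x n) ^+ 2
    <= N%:R^-1 * \sum_(0 <= n < N) x n ^+ 2.
Proof.
case: N => [|N]; first by rewrite invr0 !mul0r expr0n.
have := sum_cauchy_schwarz (index_iota 0 N.+1) x (fun=> 1).
under eq_bigr do rewrite mulr1.
under [X in _ * X]eq_bigr do rewrite expr1n.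
rewrite sumr_const_nat subn0 => h.
rewrite exprMn -mulrA ler_wpM2l ?invr_ge0 //.
by rewrite ler_pdivrMl ?ltr0n // mulrC.
Qed.

Lemma mean_norm_le (R : realType) (N : nat) (x : nat -> R) (C : R) :
  0 <= C -> (forall n, (n < N)%N -> `|x n| <= C) ->
  `|N%:R^-1 * \sum_(0 <= n < N) x n| <= C.
Proof.
move=> C0; case: N => [|N] hx; first by rewrite invr0 mul0r normr0.
rewrite normrM ger0_norm ?invr_ge0 // ler_pdivrMl ?ltr0n //.
apply: le_trans (ler_norm_sum _ _ _) _.
apply: (@le_trans _ _ (\sum_(0 <= n < N.+1) C)); first exact: ler_sum_nat.
by rewrite sumr_const_nat subn0 mulr_natl.
Qed.

Lemma prod_norm_le1 (R : realDomainType) (I : finType) (x : I -> R) :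
  (forall i, `|x i| <= 1) -> `|\prod_i x i| <= 1.
Proof.
move=> hx; rewrite normr_prod; apply: prodr_ile1 => i _.
by rewrite normr_ge0 hx.
Qed.

(** * The normalized [L2] norm *)

Section L2norm.
Variables (R : realType) (T : finType).
Implicit Types g h : T -> R.

Lemma L2norm_ge0 g : 0 <= L2norm g.
Proof. exact: sqrtr_ge0. Qed.

Lemma sqr_L2norm g : L2norm g ^+ 2 = #|T|%:R^-1 * \sum_x g x ^+ 2.
Proof.
rewrite sqr_sqrtr; last first.
  by rewrite mulr_ge0 ?invr_ge0 // sumr_ge0 // => x _; apply: sqr_ge0.
by congr (_ * _); apply: eq_bigr => x _; rewrite real_normK ?num_real.
Qed.

Lemma L2norm_le_sqr g (c : R) :
  0 <= c -> #|T|%:R^-1 * \sum_x g x ^+ 2 <= c ^+ 2 -> L2norm g <= c.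
Proof.
by move=> c0; rewrite -sqr_L2norm ler_pXn2r ?nnegrE ?L2norm_ge0.
Qed.

Lemma eq_L2norm g h : g =1 h -> L2norm g = L2norm h.
Proof.
by move=> gh; congr (Num.sqrt (_ * _)); apply: eq_bigr => x _; rewrite gh.
Qed.

Lemma L2norm_le_sup g (c : R) :
  0 <= c -> (forall x, `|g x| <= c) -> L2norm g <= c.
Proof.
move=> c0 hg; apply: L2norm_le_sqr => //.
have [/eqP T0|Tn0] := boolP (#|T| == 0)%N.
  by rewrite T0 invr0 mul0r sqr_ge0.
rewrite ler_pdivrMl ?ltr0n ?lt0n //.
apply: (@le_trans _ _ (\sum_(x : T) c ^+ 2)); last first.
  by rewrite sumr_const mulr_natl.
apply: ler_sum => x _; rewrite -(@real_normK _ (g x)) ?num_real //.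
by rewrite ler_pXn2r ?nnegrE.
Qed.

Lemma L2normD g h : L2norm (fun x => g x + h x) <= L2norm g + L2norm h.
Proof.
apply: L2norm_le_sqr; first by rewrite addr_ge0 ?L2norm_ge0.
have cs := sum_cauchy_schwarz (index_enum T) g h.
have -> : \sum_x (g x + h x) ^+ 2
    = \sum_x g x ^+ 2 + 2 * (\sum_x g x * h x) + \sum_x h x ^+ 2.
  rewrite mulr_sumr -!big_split; apply: eq_bigr => x _ /=; ring.
have := L2norm_ge0 g; have := L2norm_ge0 h.
have := sqr_L2norm g; have := sqr_L2norm h.
have : 0 <= #|T|%:R^-1 :> R by rewrite invr_ge0.
move: cs; move: (L2norm g) (L2norm h) (\sum_x g x * h x)
   (\sum_x g x ^+ 2) (\sum_x h x ^+ 2) (#|T|%:R^-1 : R)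
   => a b p A B t cs t0 hB hA b0 a0.
(* Only the cross term is at issue: this is Cauchy-Schwarz for the inner product normalized by
   [t]. *)
suff : t * p <= a * b by rewrite sqrrD hA hB; lra.
apply: (le_trans (ler_norm _)).
rewrite -(@ler_pXn2r _ 2) ?nnegrE ?mulr_ge0 // real_normK ?num_real //.
rewrite !exprMn hA hB.
have : t ^+ 2 * p ^+ 2 <= t ^+ 2 * (A * B) by rewrite ler_wpM2l ?sqr_ge0.
lra.
Qed.

Lemma L2normN g : L2norm (fun x => - g x) = L2norm g.
Proof.
by congr (Num.sqrt (_ * _)); apply: eq_bigr => x _; rewrite normrN.
Qed.

Lemma L2normB g h : L2norm (fun x => g x - h x) <= L2norm g + L2norm h.
Proof. by rewrite -(L2normN h) L2normD. Qed.

End L2norm.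

(** * Weighted averages of translates, their adjoints, and shifted sums *)

Section WeightedAverage.
Variables (R : realType) (G : finZmodType) (t : nat -> G) (w : nat -> G -> R).
Variable (N : nat).
Hypothesis w1 : forall n a, `|w n a| <= 1.
Implicit Types r h : G -> R.

Definition wavg r (a : G) : R :=
  N%:R^-1 * \sum_(0 <= n < N) r (a + t n) * w n a.

Definition wavg_adj r (a : G) : R :=
  N%:R^-1 * \sum_(0 <= n < N) r (a - t n) * w n (a - t n).

Lemma wavgD r h a : wavg (fun b => r b + h b) a = wavg r a + wavg h a.
Proof.
rewrite /wavg -mulrDr -big_split; congr (_ * _).
by apply: eq_bigr => n _; rewrite mulrDl.
Qed.

Lemma mulr_weight_le (x c : R) n a : `|x| <= c -> `|x * w n a| <= c.
Proof.
move=> xc; rewrite normrM -[c]mulr1.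
exact: ler_pM.
Qed.

Lemma wavg_norm_le r (C : R) a :
  0 <= C -> (forall b, `|r b| <= C) -> `|wavg r a| <= C.
Proof.
by move=> C0 rC; apply: mean_norm_le => // n _; apply: mulr_weight_le.
Qed.

Lemma wavg_adj_norm_le r (C : R) a :
  0 <= C -> (forall b, `|r b| <= C) -> `|wavg_adj r a| <= C.
Proof.
by move=> C0 rC; apply: mean_norm_le => // n _; apply: mulr_weight_le.
Qed.

Lemma sum_translate r (b : G) : \sum_a r (a + b) = \sum_a r a.
Proof. by rewrite [RHS](reindex_inj (addIr b)). Qed.

(** Jensen moves the square inside the mean over [n], the weights are at most 1 in absolute value,
    and translation preserves the energy of [r]. *)
Lemma L2norm_wavg_adj r : L2norm (wavg_adj r) <= L2norm r.
Proof.
apply: L2norm_le_sqr; first exact: L2norm_ge0.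
rewrite sqr_L2norm ler_wpM2l ?invr_ge0 //.
apply: (@le_trans _ _
  (\sum_a N%:R^-1 * \sum_(0 <= n < N) r (a - t n) ^+ 2)).
  apply: ler_sum => a _; apply: le_trans (sqr_mean_le _ _) _.
  rewrite ler_wpM2l ?invr_ge0 //; apply: ler_sum => n _.
  rewrite -[leRHS]real_normK ?num_real // -[leLHS]real_normK ?num_real //.
  by rewrite ler_pXn2r ?nnegrE // mulr_weight_le.
rewrite -mulr_sumr exchange_big /=.
under eq_bigr do rewrite (sum_translate (fun a => r a ^+ 2)).
rewrite sumr_const_nat subn0.
case: N => [|M].
  by rewrite invr0 mul0r sumr_ge0 // => a _; apply: sqr_ge0.
by rewrite -[X in _ * X]mulr_natl mulrA mulVf ?mul1r ?pnatr_eq0.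
Qed.

Lemma wavg_adjP r h : \sum_a wavg r a * h a = \sum_a r a * wavg_adj h a.
Proof.
transitivity (N%:R^-1 * \sum_(0 <= n < N) \sum_a r (a + t n) * w n a * h a).
  rewrite exchange_big mulr_sumr; apply: eq_bigr => a _ /=.
  by rewrite -mulrA mulr_suml.
under eq_bigr => n _.
  rewrite -(sum_translate (fun a => r (a + t n) * w n a * h a) (- t n)).
  under eq_bigr do rewrite subrK.
  over.
rewrite exchange_big mulr_sumr; apply: eq_bigr => a _ /=.
rewrite /wavg_adj mulrCA; congr (_ * _); rewrite mulr_sumr.
apply: eq_bigr => n _; ring.
Qed.

(** Expand the square: by adjointness the cross term is [- 2 * L2norm (wavg r) ^+ 2], and by
    contraction the last term gives back at most half of it. *)
Lemma energy_decrement r :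
  L2norm (fun a => r a - wavg_adj (wavg r) a) ^+ 2
    <= L2norm r ^+ 2 - L2norm (wavg r) ^+ 2.
Proof.
have := L2norm_wavg_adj (wavg r).
rewrite -(@ler_pXn2r _ 2) ?nnegrE ?L2norm_ge0 // !sqr_L2norm => hadj.
have -> : \sum_a (r a - wavg_adj (wavg r) a) ^+ 2
    = \sum_a r a ^+ 2 - 2 * (\sum_a r a * wavg_adj (wavg r) a)
      + \sum_a wavg_adj (wavg r) a ^+ 2.
  rewrite mulr_sumr -sumrB -big_split; apply: eq_bigr => a _ /=; ring.
rewrite -wavg_adjP.
under [\sum_a wavg r a * _]eq_bigr do rewrite -expr2.
lra.
Qed.

End WeightedAverage.

(** The two sums share [N - m] terms; each keeps [m] unmatched terms at one end. *)
Lemma sum_shift_dist (R : realType) (C : R) (m N : nat) (phi psi : nat -> R) :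
  (m <= N)%N -> (forall n, psi (n + m)%N = phi n) ->
  (forall n, `|phi n| <= C) -> (forall n, `|psi n| <= C) ->
  `|\sum_(0 <= n < N) psi n - \sum_(0 <= n < N) phi n| <= 2 * m%:R * C.
Proof.
move=> mN shift phiC psiC.
rewrite (big_cat_nat (n := m)) //= -{2}[m]add0n big_addn.
rewrite [\sum_(0 <= n < N) phi n](big_cat_nat (n := (N - m)%N)) ?leq_subr //=.
under [\sum_(0 <= n < N - m) psi _]eq_bigr do rewrite shift.
have -> : forall x y z : R, x + y - (y + z) = x - z by move=> x y z; ring.
apply: (le_trans (ler_normB _ _)).
have -> : 2 * m%:R * C = m%:R * C + m%:R * C by ring.
apply: lerD; apply: (le_trans (ler_norm_sum _ _ _)).
  by apply: (le_trans (ler_sum _ (fun n _ => psiC n)));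
    rewrite sumr_const_nat subn0 mulr_natl.
by apply: (le_trans (ler_sum _ (fun n _ => phiC n)));
  rewrite sumr_const_nat subKn // mulr_natl.
Qed.

(** * Multiple averages on finite abelian groups, and averages of structured functions *)

Section Averages.
Variables (R : realType) (l : nat).

Definition shift_prod (G : finZmodType) (u : 'I_l -> G) (f : 'I_l -> G -> R)
  (n : nat) (a : G) : R := \prod_(i < l) f i (a + u i *+ n).

Definition mavg (G : finZmodType) (u : 'I_l -> G) (f : 'I_l -> G -> R)
  (N : nat) (a : G) : R := N%:R^-1 * \sum_(0 <= n < N) shift_prod u f n a.

(** The average of [l.+1] functions, as a linear operator on the one shifted by [v]; the other [l]
    form the weight. *)
Definition last_avg (G : finZmodType) (v : G) (u : 'I_l -> G)
    (f : 'I_l -> G -> R) (N : nat) : (G -> R) -> G -> R :=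
  wavg (fun n => v *+ n) (shift_prod u f) N.

Definition last_adj (G : finZmodType) (v : G) (u : 'I_l -> G)
    (f : 'I_l -> G -> R) (N : nat) : (G -> R) -> G -> R :=
  wavg_adj (fun n => v *+ n) (shift_prod u f) N.

Lemma shift_prod_norm_le1 (G : finZmodType) (u : 'I_l -> G) f n a :
  (forall i b, `|f i b| <= 1) -> `|shift_prod u f n a| <= 1.
Proof. by move=> f1; apply: prod_norm_le1. Qed.

Definition lift_gen (G : finZmodType) (n0 : nat) (u : 'I_l -> G) (i : 'I_l) :
  (G * 'I_n0.+1)%type := (u i, 0).

Lemma add_lift_gen (G : finZmodType) (n0 : nat) (u : 'I_l -> G) i a n m :
  (a, n) + lift_gen n0 u i *+ m = (a + u i *+ m, n).
Proof.
rewrite pairMnE; apply: injective_projections => //=.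
by rewrite mul0rn addr0.
Qed.

(** At [(a + u i *+ m, n)] the first factor is the weight of the outer average at time [m], the
    second that of the adjoint at time [n], once [n] is replaced by [n + m]. *)
Definition lift_fun (G : finZmodType) (n0 : nat) (v : G) (u : 'I_l -> G)
    (f : 'I_l -> G -> R) (i : 'I_l) (p : (G * 'I_n0.+1)%type) : R :=
  f i p.1 * f i (p.1 - v *+ p.2 + u i *+ p.2).

(** The argument of [w] in the double sum involves only [n - m]. Replacing [n] by [n + m] (from
    [psi] to [phi]) frees it of [m], at the cost of boundary terms; what remains in [m] is an
    average of [l] functions. *)
Lemma last_avg_adj_approx (G : finZmodType) (n0 : nat) (v : G)
    (u : 'I_l -> G) (f : 'I_l -> G -> R) (w : G -> R) (C : R) (N : nat)
    (a : G) :
  (forall i b, `|f i b| <= 1) -> 0 <= C -> (forall b, `|w b| <= C) ->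
  (N <= n0.+1)%N ->
  `|last_avg v u f N (last_adj v u f n0.+1 w) a
    - n0.+1%:R^-1 * \sum_(n < n0.+1) w (a - v *+ n) *
        mavg (lift_gen n0 u) (lift_fun v u f) N (a, n)|
  <= 2 * N%:R * C / n0.+1%:R.
Proof.
move=> f1 C0 wC NN0.
pose phi m n := w (a - v *+ n) *
  \prod_(i < l) f i (a - v *+ n + u i *+ n + u i *+ m).
pose psi m n := w (a + v *+ m - v *+ n) *
  \prod_(i < l) f i (a + v *+ m - v *+ n + u i *+ n).
pose N0 := n0.+1.
have -> : last_avg v u f N (last_adj v u f N0 w) a = N%:R^-1 *
    \sum_(0 <= m < N)
      (N0%:R^-1 * \sum_(0 <= n < N0) psi m n) * shift_prod u f m a.
  by [].
have -> : N0%:R^-1 * \sum_(n < N0) w (a - v *+ n) *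
        mavg (lift_gen n0 u) (lift_fun v u f) N (a, n)
   = N%:R^-1 *
    \sum_(0 <= m < N)
      (N0%:R^-1 * \sum_(0 <= n < N0) phi m n) * shift_prod u f m a.
  rewrite /mavg.
  under eq_bigr do rewrite mulrCA.
  rewrite -mulr_sumr mulrCA; congr (_ * _).
  under eq_bigr do rewrite mulr_sumr.
  rewrite exchange_big mulr_sumr; apply: eq_bigr => m _ /=.
  rewrite -mulrA; congr (_ * _); rewrite big_mkord mulr_suml.
  apply: eq_bigr => n _; rewrite /phi -mulrA; congr (_ * _).
  rewrite /shift_prod -big_split; apply: eq_bigr => i _.
  rewrite add_lift_gen /lift_fun /= mulrC; congr (f i _ * _).
  by rewrite [RHS]addrAC [a - _ + _]addrAC.
rewrite -mulrBr -sumrB; apply: mean_norm_le => [|m mN].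
  by rewrite divr_ge0 ?mulr_ge0.
rewrite -mulrBl normrM -[leRHS]mulr1; apply: ler_pM => //; last first.
  exact: shift_prod_norm_le1.
rewrite -mulrBr normrM ger0_norm ?invr_ge0 // mulrC ler_wpM2r ?invr_ge0 //.
apply: (@le_trans _ _ (2 * m%:R * C)); last first.
  by rewrite ler_wpM2r // ler_wpM2l // ler_nat ltnW.
have bound x (y : 'I_l -> R) : `|x| <= C -> (forall i, `|y i| <= 1) ->
    `|x * \prod_(i < l) y i| <= C.
  move=> xC y1; rewrite normrM -[C]mulr1; apply: ler_pM => //.
  exact: prod_norm_le1.
apply: sum_shift_dist => [|n|n|n]; rewrite ?bound //.
- exact: leq_trans (ltnW mN) NN0.
- rewrite /psi /phi.
  have -> : a + v *+ m - v *+ (n + m) = a - v *+ n.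
    by rewrite mulrnDr opprD addrACA subrr addr0.
  by under eq_bigr do rewrite mulrnDr addrA.
Qed.

(* Jensen: averaging over [n] against [w] costs a factor [C] from the [L2] norm
   over [G] to the [L2] norm over [G * 'I_n0.+1]. *)
Lemma L2norm_fiber_mean (G : finZmodType) (n0 : nat) (v : G) (w : G -> R)
    (C : R) (D : (G * 'I_n0.+1)%type -> R) :
  0 <= C -> (forall b, `|w b| <= C) ->
  L2norm (fun a => n0.+1%:R^-1 * \sum_(n < n0.+1) w (a - v *+ n) * D (a, n))
    <= C * L2norm D.
Proof.
move=> C0 wC; apply: L2norm_le_sqr; first by rewrite mulr_ge0 ?L2norm_ge0.
rewrite exprMn sqr_L2norm card_prod card_ord.
have -> : \sum_p D p ^+ 2 = \sum_a \sum_n D (a, n) ^+ 2.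
  by rewrite pair_bigA; apply: eq_bigr => -[].
rewrite natrM invfM.
rewrite -[_ / _ * _]mulrA [leRHS]mulrCA ler_wpM2l ?invr_ge0 //.
rewrite mulr_sumr mulr_sumr; apply: ler_sum => a _.
have := sqr_mean_le n0.+1 (fun n => w (a - v *+ n) * D (a, inord n)).
rewrite !big_mkord.
under eq_bigr do rewrite inord_val.
under [X in _ <= _ * X]eq_bigr do rewrite inord_val.
move=> h; apply: (le_trans h).
rewrite mulrCA ler_wpM2l ?invr_ge0 // mulr_sumr; apply: ler_sum => n _.
rewrite exprMn ler_wpM2r ?sqr_ge0 // -(@real_normK _ (w _)) ?num_real //.
by rewrite ler_pXn2r ?nnegrE.
Qed.

(** Group, shifts and functions are hidden in a class of distance functions, so that a bound for the
    class is uniform in all of them. *)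
Definition mavg_dist (d : nat -> nat -> R) : Prop :=
  exists (G : finZmodType) (u : 'I_l -> G) (f : 'I_l -> G -> R),
    (forall i a, `|f i a| <= 1) /\
    d = fun N N' => L2norm (fun a => mavg u f N a - mavg u f N' a).

(** Each of the two averages is replaced by its fiber mean at cost [2 * L%:R * C / n0.+1%:R]; the
    difference of the fiber means is bounded by Jensen. *)
Lemma last_avg_adj_dist (G : finZmodType) (n0 : nat) (v : G)
    (u : 'I_l -> G) (f : 'I_l -> G -> R) (w : G -> R) (C : R) :
  (forall i b, `|f i b| <= 1) -> 0 <= C -> (forall b, `|w b| <= C) ->
  exists d, mavg_dist d /\
  forall L N N', (N <= L)%N -> (N' <= L)%N -> (L <= n0.+1)%N ->
  L2norm (fun a => last_avg v u f N (last_adj v u f n0.+1 w) a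
                 - last_avg v u f N' (last_adj v u f n0.+1 w) a)
  <= C * d N N' + 4 * L%:R * C / n0.+1%:R.
Proof.
move=> f1 C0 wC.
pose B N := mavg (lift_gen n0 u) (lift_fun v u f) N.
exists (fun N N' => L2norm (fun p => B N p - B N' p)); split.
  exists (G * 'I_n0.+1)%type, (lift_gen n0 u), (lift_fun v u f).
  split=> // i p; rewrite /lift_fun normrM -[1]mulr1; exact: ler_pM.
move=> L N N' NL N'L Ln0.
pose E N a := n0.+1%:R^-1 * \sum_(n < n0.+1) w (a - v *+ n) * B N (a, n).
pose S N a := last_avg v u f N (last_adj v u f n0.+1 w) a.
have SE K a : (K <= L)%N -> `|S K a - E K a| <= 2 * L%:R * C / n0.+1%:R.
  move=> KL; apply: (le_trans (last_avg_adj_approx _ _ _ f1 C0 wC _)).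
    exact: leq_trans KL Ln0.
  by rewrite ler_wpM2r ?invr_ge0 // ler_wpM2r // ler_wpM2l // ler_nat.
rewrite (@eq_L2norm _ _ _ (fun a => (E N a - E N' a)
   + ((S N a - E N a) - (S N' a - E N' a)))); last first.
  by move=> a; rewrite /S; ring.
apply: (le_trans (L2normD _ _)); apply: lerD.
  apply: le_trans (L2norm_fiber_mean v (fun p => B N p - B N' p) C0 wC).
  rewrite (@eq_L2norm _ _ _ (fun a => n0.+1%:R^-1 *
    \sum_(n < n0.+1) w (a - v *+ n) * (B N (a, n) - B N' (a, n)))) //.
  move=> a; rewrite /E -mulrBr -sumrB; congr (_ * _).
  by apply: eq_bigr => n _; rewrite mulrBr.
apply: L2norm_le_sup => [|a]; first by rewrite divr_ge0 ?mulr_ge0.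
apply: (le_trans (ler_normB _ _)).
have -> : 4 * L%:R * C / n0.+1%:R
  = 2 * L%:R * C / n0.+1%:R + 2 * L%:R * C / n0.+1%:R by ring.
by apply: lerD; apply: SE.
Qed.

End Averages.

(** * Metastability and the energy iteration *)

Section Metastability.
Variable R : realType.
Implicit Types D : (nat -> nat -> R) -> Prop.

(** [Mstar] is uniform over the class [D]. The lower bound [m0] allows the scale to be forced above
    any threshold, as the choice of decreasing scales requires. *)
Definition metastable D : Prop :=
  forall eps : R, 0 < eps -> forall (F : nat -> nat) (m0 : nat),
  exists Mstar : nat, forall d, D d ->
  exists M : nat, (m0 <= M <= Mstar)%N /\
    forall N N', (M <= N <= F M)%N -> (M <= N' <= F M)%N -> d N N' <= eps.

Definition add_scaled D1 (c : R) D2 (d : nat -> nat -> R) : Prop :=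
  exists d1 d2, [/\ D1 d1, D2 d2 & d = fun N N' => d1 N N' + c * d2 N N'].

Lemma leq_bigmax_nat (F : nat -> nat) (m n : nat) :
  (m <= n)%N -> (F m <= \max_(k < n.+1) F k)%N.
Proof. by move=> mn; apply: (leq_bigmax (Ordinal (mn : (m < n.+1)%N))). Qed.

(* The interval supplied by [D1] is taken so long that, wherever it starts, it
   contains an interval on which [D2] is stable. *)
Lemma metastable_add_scaled D1 D2 (c : R) :
  0 < c -> metastable D1 -> metastable D2 -> metastable (add_scaled D1 c D2).
Proof.
move=> c0 meta1 meta2 eps eps0 F m0.
have e1 : 0 < eps / 2 by rewrite divr_gt0.
have e2 : 0 < eps / (2 * c) by rewrite divr_gt0 // mulr_gt0.
have [M2 hM2] := choice (meta2 _ e2 F).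
(* The maximum is taken because [M] is only known to be at most [M2 m], and [F] need not be
   monotone. *)
have [M1 hM1] := meta1 _ e1 (fun m => \max_(k < (M2 m).+1) F k)%N m0.
exists (\max_(m < M1.+1) M2 m)%N => _ [d1 [d2 [Dd1 Dd2 ->]]].
have [m [/andP[m0m mM1] stable1]] := hM1 d1 Dd1.
have [M [/andP[mM MM2] stable2]] := hM2 m d2 Dd2.
exists M; split.
  by rewrite (leq_trans m0m mM) (leq_trans MM2) // (leq_bigmax_nat M2).
have FM := leq_bigmax_nat F MM2.
move=> N N' hN hN'.
have h1 : d1 N N' <= eps / 2.
  move: hN hN' => /andP[MN NF] /andP[MN' NF'].
  by apply: stable1; rewrite (leq_trans mM) ?(leq_trans _ FM).
have h2 : c * d2 N N' <= eps / 2.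
  have := stable2 N N' hN hN'.
  rewrite -(ler_pM2l c0) => /le_trans; apply.
  by have -> : c * (eps / (2 * c)) = eps / 2 by field; rewrite gt_eqF.
lra.
Qed.

Lemma eq_wavg (G : finZmodType) t (w : nat -> G -> R) N (r h : G -> R) a :
  r =1 h -> wavg t w N r a = wavg t w N h a.
Proof.
by move=> rh; congr (_ * _); apply: eq_bigr => n _; rewrite rh.
Qed.

(* [g - r] is the part of [g] already known to be structured and [k] bounds the
   number of energy decrements still possible. *)
Lemma energy_iteration (l : nat) (delta : R) (F : nat -> nat) (m0 k : nat) D
    (C tau : R) :
  metastable (@mavg_dist R l) -> 0 < delta ->
  metastable D -> 0 < C -> 0 < tau ->
  exists L : nat, forall (G : finZmodType) (v : G) (u : 'I_l -> G)
    (f : 'I_l -> G -> R) (g r : G -> R) (d : nat -> nat -> R) (e : R),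
    (forall i a, `|f i a| <= 1) -> (forall a, `|r a| <= C) ->
    L2norm r ^+ 2 < k%:R * delta ^+ 2 -> D d ->
    (forall N N', (N <= L)%N -> (N' <= L)%N ->
      L2norm (fun a => last_avg v u f N (fun b => g b - r b) a
                     - last_avg v u f N' (fun b => g b - r b) a)
        <= d N N' + e) ->
  exists M : nat, (m0 <= M <= L)%N /\
    forall N N', (M <= N <= F M)%N -> (M <= N' <= F M)%N ->
      L2norm (fun a => last_avg v u f N g a - last_avg v u f N' g a)
        <= e + tau + 2 * delta.
Proof.
move=> metal delta0; elim: k D C tau => [|k IH] D C tau metaD C0 tau0.
  by exists 0%N => G v u f g r d e _ _; rewrite mul0r ltNge sqr_ge0.
have C20 : 0 < 2 * C by rewrite mulr_gt0.
have tau20 : 0 < tau / 2 by rewrite divr_gt0.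
(* Removing a structured piece adds a [C]-multiple of a distance for [l] functions, doubles the sup
   bound and spends half of [tau]. *)
have [L' hL'] := IH _ _ _ (metastable_add_scaled C0 metaD metal) C20 tau20.
(* Any scale [N0 >= m1] is positive, exceeds [L'], and makes the boundary error
   [4 * L'%:R * C / N0%:R] at most [tau / 2]. *)
pose m1 := maxn m0 (maxn L' (Num.bound (8 * L'%:R * C / tau))).+1.
have [Ms hMs] := metaD tau tau0 F m1.
(* Large enough to contain the window up to [F M] for every [M <= Ms], hence also [L'] when a scale
   [N0] in that window is used. *)
exists (maxn Ms (\max_(m < Ms.+1) F m)) => G v u f g r d e.
move=> f1 rC energy Dd close.
have [M [/andP[m1M MMs] stable]] := hMs d Dd.
have FM : (F M <= maxn Ms (\max_(m < Ms.+1) F m))%N.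
  by rewrite leq_max (leq_bigmax_nat F MMs) orbT.
have [/existsP[N0 /andP[MN0 big]]|] :=
  boolP [exists N : 'I_(F M).+1,
    (M <= N)%N && (delta < L2norm (last_avg v u f N r))].
  have L'N0 : (L' <= N0)%N.
    by apply: leq_trans MN0; apply: leq_trans m1M; rewrite /m1; lia.
  have N0big : 8 * L'%:R * C / tau < N0%:R.
    apply: (@lt_le_trans _ _ (Num.bound (8 * L'%:R * C / tau))%:R).
      apply: archi_boundP; apply: divr_ge0; last exact: ltW.
      by rewrite !mulr_ge0 // ltW.
    by rewrite ler_nat; move: (leq_trans m1M MN0); rewrite /m1; lia.
  have L'L : (L' <= maxn Ms (\max_(m < Ms.+1) F m))%N.
    by apply: leq_trans L'N0 _; apply: leq_trans FM; rewrite -ltnS.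
  have N0gt : (0 < N0)%N by move: (leq_trans m1M MN0); rewrite /m1; lia.
  pose w := last_avg v u f N0 r.
  pose h := last_adj v u f N0 w.
  have shift1 n a : `|shift_prod u f n a| <= 1 by apply: shift_prod_norm_le1.
  have wC a : `|w a| <= C by apply: wavg_norm_le => //; apply: ltW.
  have hC a : `|h a| <= C by apply: wavg_adj_norm_le => //; apply: ltW.
  have [d2 [md2 hd2]] : exists d2, mavg_dist l d2 /\
      forall N N', (N <= L')%N -> (N' <= L')%N ->
        L2norm (fun a => last_avg v u f N h a - last_avg v u f N' h a)
          <= C * d2 N N' + tau / 2.
    have := last_avg_adj_dist N0.-1 v u f1 (ltW C0) wC.
    rewrite prednK // => -[d2 [md2 hd2]]; exists d2; split=> // N N' NL N'L.
    apply: (le_trans (hd2 L' N N' NL N'L L'N0)); rewrite lerD2l.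
    rewrite ler_pdivrMr ?ltr0n //.
    by move: N0big; rewrite ltr_pdivrMr //; lra.
  have [] := hL' G v u f g (fun a => r a - h a)
      (fun N N' => d N N' + C * d2 N N') (e + tau / 2) f1.
  - move=> a; apply: (le_trans (ler_normB _ _)).
    by have := rC a; have := hC a; lra.
  (* The new residual has lost more than [delta ^+ 2], so [k] decrements remain. *)
  - apply: le_lt_trans (energy_decrement _ _ shift1 r) _.
    have : delta ^+ 2 < L2norm w ^+ 2.
      by rewrite ltr_pXn2r ?nnegrE ?L2norm_ge0 // ltW.
    by move: energy; rewrite -natr1 mulrDl mul1r /w /last_avg; lra.
  - by exists d, d2.
  - move=> N N' NL N'L.
    have split_avg K a : last_avg v u f K (fun b => g b - (r b - h b)) a
        = last_avg v u f K (fun b => g b - r b) a + last_avg v u f K h a.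
      by rewrite -wavgD; apply: eq_wavg => b; ring.
    rewrite (@eq_L2norm _ _ _ (fun a =>
      (last_avg v u f N (fun b => g b - r b) a
       - last_avg v u f N' (fun b => g b - r b) a)
      + (last_avg v u f N h a - last_avg v u f N' h a))); last first.
      by move=> a; rewrite !split_avg; ring.
    apply: (le_trans (L2normD _ _)).
    have := close N N' (leq_trans NL L'L) (leq_trans N'L L'L).
    by have := hd2 N N' NL N'L; lra.
  move=> M' [/andP[m0M' M'L'] stable']; exists M'; split.
    by rewrite m0M' (leq_trans M'L').
  move=> N N' hN hN'; apply: (le_trans (stable' N N' hN hN')); lra.
(* No scale in the window is large on [r]: the structured part varies by at most [e + tau], and the
   residual by at most [2 * delta]. *)
rewrite negb_exists => /forallP small; exists M; split.
  by rewrite (leq_trans (leq_maxl m0 _) m1M) leq_max MMs.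
have small_r N : (M <= N <= F M)%N -> L2norm (last_avg v u f N r) <= delta.
  move=> /andP[MN NF]; have := small (Ordinal (NF : (N < (F M).+1)%N)).
  by rewrite /= MN /= -leNgt.
move=> N N' hN hN'.
rewrite (@eq_L2norm _ _ _ (fun a =>
  (last_avg v u f N (fun b => g b - r b) a
   - last_avg v u f N' (fun b => g b - r b) a)
  + (last_avg v u f N r a - last_avg v u f N' r a))); last first.
  have split_avg K a : last_avg v u f K g a
      = last_avg v u f K (fun b => g b - r b) a + last_avg v u f K r a.
    by rewrite -wavgD; apply: eq_wavg => b; ring.
  by move=> a; rewrite !split_avg; ring.
apply: (le_trans (L2normD _ _)).
have := L2normB (last_avg v u f N r) (last_avg v u f N' r).
have := small_r N hN; have := small_r N' hN'.
have := stable N N' hN hN'.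
move: hN hN' => /andP[_ NF] /andP[_ NF'].
have := close N N' (leq_trans NF FM) (leq_trans NF' FM); lra.
Qed.

(** The empty product makes every average 1, except at [N = 0] where it is 0; hence [maxn m0 1]. *)
Lemma metastable_mavg0 : metastable (@mavg_dist R 0).
Proof.
move=> eps eps0 F m0; exists (maxn m0 1) => _ [G [u [f [_ ->]]]].
exists (maxn m0 1); rewrite leq_maxl leqnn; split=> // N N' hN hN'.
have avg1 K a : (0 < K)%N -> mavg u f K a = 1.
  move=> K0; rewrite /mavg (eq_bigr (fun=> 1)); last first.
    by move=> n _; rewrite /shift_prod big_ord0.
  by rewrite sumr_const_nat subn0 mulVf // pnatr_eq0 -lt0n.
apply: L2norm_le_sup => [|a]; first exact: ltW.
by rewrite !avg1 ?subrr ?normr0 ?ltW //; lia.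
Qed.

Lemma metastable_mavgS (l : nat) :
  metastable (@mavg_dist R l) -> metastable (@mavg_dist R l.+1).
Proof.
move=> metal eps eps0 F m0.
(* With [e = 0], the final error [tau + 2 * delta] is exactly [eps]. *)
have delta0 : 0 < eps / 4 by rewrite divr_gt0.
have tau0 : 0 < eps / 2 by rewrite divr_gt0.
pose D0 (d : nat -> nat -> R) := d = fun _ _ => 0.
have meta0 : metastable D0.
  move=> e e0 F' m; exists m => _ ->; exists m.
  by rewrite leqnn; split=> // *; apply: ltW.
(* The iteration starts with everything in the residual, [r = g = f ord0], of energy at most 1; this
   [k] gives [1 < k%:R * delta ^+ 2]. *)
have [L hL] := energy_iteration F m0 (Num.bound ((eps / 4) ^- 2))
  metal delta0 meta0 ltr01 tau0.
exists L => _ [G [u [f [f1 ->]]]].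
pose u' i := u (lift ord0 i); pose f' i := f (lift ord0 i).
have avgE K a : mavg u f K a = last_avg (u ord0) u' f' K (f ord0) a.
  congr (_ * _); apply: eq_bigr => n _.
  by rewrite /shift_prod big_ord_recl.
have [] := hL G (u ord0) u' f' (f ord0) (f ord0) _ 0 _ _ _ (erefl _).
- by move=> i a; apply: f1.
- exact: f1.
- have f0 : L2norm (f ord0) ^+ 2 <= 1.
    by rewrite expr_le1 ?L2norm_ge0 // L2norm_le_sup.
  apply: (le_lt_trans f0); rewrite -ltr_pdivrMr ?exprn_gt0 // mul1r.
  by rewrite archi_boundP // invr_ge0 exprn_ge0 // ltW.
- move=> N N' _ _; rewrite addr0; apply: L2norm_le_sup => // a.
  have zero K : last_avg (u ord0) u' f' K (fun b => f ord0 b - f ord0 b) a = 0.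
    rewrite /last_avg /wavg big1 ?mulr0 // => n _.
    by rewrite subrr mul0r.
  by rewrite !zero subrr normr0.
move=> M [hM stable]; exists M; split=> // N N' hN hN'.
rewrite (@eq_L2norm _ _ _ (fun a => last_avg (u ord0) u' f' N (f ord0) a
  - last_avg (u ord0) u' f' N' (f ord0) a)); last by move=> a; rewrite !avgE.
apply: (le_trans (stable N N' hN hN')); lra.
Qed.

Lemma metastable_mavg (l : nat) : metastable (@mavg_dist R l).
Proof.
by elim: l => [|l]; [apply: metastable_mavg0 | apply: metastable_mavgS].
Qed.

End Metastability.

Theorem theorem1p6 (R : realType) (l : nat) (hl : (1 <= l)%N)
    (F : nat -> nat) (hF : forall m : nat, (1 <= m)%N -> (1 <= F m)%N)
    (eps : R) (heps : 0 < eps) :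
  exists Mstar : nat, (0 < Mstar)%N /\
    forall (P : nat), (1 <= P)%N ->
    forall (f : 'I_l -> torus P l -> R),
      (forall (i : 'I_l) (a : torus P l), -1 <= f i a <= 1) ->
      exists M : nat, (1 <= M <= Mstar)%N /\
        forall N N' : nat,
          (M <= N <= F M)%N -> (M <= N' <= F M)%N ->
          L2norm (fun a : torus P l => ergodic_avg f N a - ergodic_avg f N' a)
            <= eps.
Proof.
have [Ms hMs] := @metastable_mavg R l eps heps F 1.
exists (maxn Ms 1); split; first by rewrite leq_max orbT.
move=> P _ f f1.
have [|M [/andP[M1 MMs] stable]] :=
  hMs (fun N N' => L2norm (fun a : torus P l =>
         ergodic_avg f N a - ergodic_avg f N' a)).
  (* On the torus with shifts [gen], [mavg] unfolds to [ergodic_avg]. *)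
  exists (torus P l), (@gen P l), f; split=> // i a.
  by rewrite ler_norml.
by exists M; rewrite M1 leq_max MMs.
Qed.
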